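(* Assume Conjecture 1 (stated in the context). Then, for each fixed $y\in\mathbb{N}$, $$\limsup_{x\to\infty}\frac{W(x,y)\log\log x}{\log x}=1,$$ where $x$ runs through the integers.
   Context: $\mathbb{N}$ denotes the positive integers and $\log$ the natural logarithm. For $n\in\mathbb{N}$, $\omega(n)$ is the number of distinct prime divisors of $n$ and $\gamma(n):=\prod_{p\mid n}p$ is the product of the distinct primes dividing $n$ (so $\gamma(1)=1$). Define $$H(n):=\frac{\gamma(n)}{(\log\gamma(n))^{\omega(n)}}\qquad(n\in\mathbb{N}),$$ with the convention $0^0=1$, so that $H(1)=1$. For $y\in\mathbb{N}$ and $x\in\mathbb{Z}_{\ge 0}$ define $$W(x,y):=\sum_{j=1}^{y}\omega(x+j).$$ Conjecture 1 is the following statement: for every $\epsilon>0$ there exists a constant $C(\epsilon)$ such that for all $(a,b,c)\in\mathbb{N}^3$ with $\gcd(a,b,c)=1$ and $a+b=c$, one has $c<C(\epsilon)\,H(abc)^{1+\epsilon}$. *)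

(* Defs.v *)
From mathcomp Require Import all_boot all_order all_algebra.
From mathcomp Require Import all_classical all_reals all_analysis.

Set Implicit Arguments.
Unset Strict Implicit.
Unset Printing Implicit Defensive.

Import Order.TTheory GRing.Theory Num.Theory.
Import numFieldNormedType.Exports.

Local Open Scope ring_scope.

Definition omega (n : nat) : nat := size (primes n).

Definition gamma (n : nat) : nat := (\prod_(p <- primes n) p)%N.

(* For n = 1 the denominator is 0 ^+ 0 = 1, so H R 1 = 1. *)
Definition H (R : realType) (n : nat) : R :=
  (gamma n)%:R / ln ((gamma n)%:R : R) ^+ omega n.

Definition W (x y : nat) : nat := (\sum_(1 <= j < y.+1) omega (x + j))%N.

Definition Conjecture1 (R : realType) : Prop :=
  forall eps : R, 0 < eps ->
    exists C : R, forall a b c : nat,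
      (0 < a)%N -> (0 < b)%N -> (0 < c)%N ->
      gcdn a (gcdn b c) = 1%N -> (a + b)%N = c ->
      c%:R < C * H R (a * b * c) `^ (1 + eps).

(* Main.v *)
Require Import Defs.
From mathcomp Require Import all_boot all_order all_algebra.
From mathcomp Require Import all_classical all_reals all_analysis.
From mathcomp Require Import zify ring lra.

Set Implicit Arguments.
Unset Strict Implicit.
Unset Printing Implicit Defensive.

Import Order.TTheory GRing.Theory Num.Theory.
Import numFieldNormedType.Exports.

Local Open Scope ring_scope.

(** Upper bound: the rational function
    [prod_(1 <= j <= n + 2) (x + j) ^ ((-1) ^ (j - 1) * C(n + 1, j - 1))] is
    ramified only over 0, 1 and infinity.  Concretely, let [A] and [B] be its numerator and
    denominator, monic of degree [d = 2 ^ n]; the exponents are those of an iterated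
    difference, so [A - B] has degree at most [d - n - 1].  Dividing [A(x)], [B(x)]
    and [|A(x) - B(x)|] by the bounded number [gcd (A(x), B(x))] gives an abc triple
    with [c >> x ^ d], [gamma (abc) << x ^ (d + 1)] and
    [omega (abc) >= W (x, n + 2) - O(1)].  Conjecture 1 then yields
    [(log x) ^ W << x ^ (1 + o(1))].  As [W] is monotone in [y], it suffices to
    treat [y = n + 2].

    Lower bound: take for [x + 1] the product of the primes up to [m] and use
    Chebyshev's lower bound for the number of these primes. *)

(** * Radical and number of prime divisors *)

Lemma prod_primes_dvd (s : seq nat) (m : nat) :
  uniq s -> all prime s -> all (fun p => p %| m)%N s ->
  (\prod_(p <- s) p %| m)%N.
Proof.
elim: s => [|p s IHs] /=; first by rewrite big_nil dvd1n.
case/andP=> ps us /andP[pp prs] /andP[pm dvs].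
rewrite big_cons Gauss_dvd ?pm ?IHs //.
rewrite prime_coprime // Euclid_dvd_prod // big_has.
apply: contraNN ps => /hasP[q qs /= pq].
by move: pq; rewrite dvdn_prime2 // ?(allP prs) // => /eqP->.
Qed.

Lemma gamma_dvd (N m : nat) : {in primes N, forall p, p %| m}%N -> (gamma N %| m)%N.
Proof.
move=> sub; apply: prod_primes_dvd; first exact: primes_uniq.
  by apply/allP => p; rewrite mem_primes => /andP[].
exact/allP.
Qed.

Lemma gamma_gt0 (N : nat) : (0 < gamma N)%N.
Proof.
rewrite /gamma big_seq; elim/big_ind: _ => // [m n|p].
  by rewrite muln_gt0 => -> ->.
by rewrite mem_primes => /andP[/prime_gt0].
Qed.

Lemma primes_gamma (N : nat) : primes (gamma N) = primes N.
Proof.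
apply: (irr_sorted_eq ltn_trans ltnn); try exact: sorted_primes.
move=> p; rewrite !mem_primes gamma_gt0 /=.
apply/andP/and3P => [[pp pN]|[pp N0 pN]]; last first.
  split=> //; have pin : p \in primes N by rewrite mem_primes pp N0.
  by rewrite /gamma (big_rem p) //= dvdn_mulr.
move: pN; rewrite /gamma Euclid_dvd_prod // big_has => /hasP[q qN /= pq].
move: qN; rewrite mem_primes => /and3P[qp N0 qN].
by move: pq; rewrite dvdn_prime2 // => /eqP->.
Qed.

Lemma omega_gamma (N : nat) : omega (gamma N) = omega N.
Proof. by rewrite /omega primes_gamma. Qed.

Lemma exp2_omega_le_gamma (N : nat) : (2 ^ omega N <= gamma N)%N.
Proof.
rewrite /omega /gamma.
have : {in primes N, forall p, 1 < p}%N.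
  by move=> p; rewrite mem_primes => /andP[/prime_gt1].
elim: (primes N) => [|p s IHs] ps; first by rewrite big_nil.
rewrite big_cons expnS leq_mul ?ps ?mem_head // IHs // => q qs.
by rewrite ps // in_cons qs orbT.
Qed.

Lemma gamma_le_exp_omega (N m : nat) : {in primes N, forall p, p <= m}%N ->
  (gamma N <= m ^ omega N)%N.
Proof.
rewrite /omega /gamma.
elim: (primes N) => [|p s IHs] ps; first by rewrite big_nil.
rewrite big_cons expnS leq_mul ?ps ?mem_head // IHs // => q qs.
by rewrite ps // in_cons qs orbT.
Qed.

(** * Chebyshev's lower bound for the number of primes *)

(** Factorials encode the prime-counting function: [omega] of m! counts the primes up to [m]. *)
Lemma primes_fact (m p : nat) : (p \in primes m`!) = prime p && (p <= m)%N.
Proof.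
rewrite mem_primes fact_gt0 /=; case pp: (prime p) => //=.
apply/idP/idP => [|pm]; last by rewrite dvdn_fact // pm prime_gt0.
elim: m => [|m IHm]; first by rewrite dvdn1 => /eqP p1; rewrite p1 in pp.
rewrite factS Euclid_dvdM // => /orP[/dvdn_leq->//|/IHm/leqW//].
Qed.

(** Legendre's formula writes the exponent as the sum over k of floor(2n/p^k) - 2 floor(n/p^k). Each
    term is at most 1, and it vanishes once p^k > 2n. *)
Lemma logn_central_bin (p n : nat) : prime p -> (0 < n)%N ->
  (p ^ logn p 'C(n.*2, n) <= n.*2)%N.
Proof.
move=> pp n0; have p1 := prime_gt1 pp.
have n20 : (0 < n.*2)%N by rewrite double_gt0.
apply: leq_trans (trunc_logP p1 n20); rewrite leq_exp2l //.
set t := trunc_log p n.*2.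
have nn : (n <= n.*2)%N by rewrite -addnn leq_addr.
have Hf : (logn p n.*2`! = logn p 'C(n.*2, n) + (logn p n`! + logn p n`!))%N.
  have n2n : (n.*2 - n = n)%N by rewrite -addnn addnK.
  by rewrite -(bin_fact nn) n2n !lognM ?muln_gt0 ?fact_gt0 ?bin_gt0.
(* Zero terms extend the sum for n! to the range of the sum for (2n)!, so that the two compare
   termwise. *)
have Hn : (logn p n`! = \sum_(1 <= k < n.*2.+1) n %/ p ^ k)%N.
  rewrite logn_fact // [RHS](big_cat_nat (n := n.+1)) //=.
  rewrite [X in (_ = _ + X)%N]big_nat [X in (_ = _ + X)%N]big1 ?addn0 // => k /andP[nk _].
  by rewrite divn_small // (leq_trans nk) // ltnW // ltn_expl.
have Ht : (\sum_(1 <= k < n.*2.+1) (k <= t) <= t)%N.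
  have -> : (\sum_(1 <= k < n.*2.+1) (k <= t) =
             size [seq k <- index_iota 1 n.*2.+1 | k <= t])%N.
    by rewrite -sum1_size big_filter -big_mkcond.
  rewrite -[X in (_ <= X)%N](size_iota 1 t); apply: uniq_leq_size.
    by rewrite filter_uniq ?iota_uniq.
  by move=> k; rewrite mem_filter !mem_iota; lia.
rewrite -(leq_add2r (logn p n`! + logn p n`!)) -Hf Hn logn_fact //.
apply: leq_trans (leq_add Ht (leqnn _)); rewrite -!big_split /=.
rewrite !big_nat; apply: leq_sum => k /andP[k1 _].
have [kt|kt] := leqP k t; last first.
  rewrite divn_small //; apply: leq_trans (trunc_log_ltn n.*2 p1) _.
  by rewrite leq_exp2l.
have P0 : (0 < p ^ k)%N by rewrite expn_gt0 prime_gt0.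
rewrite -ltnS ltn_divLR //.
have := divn_eq n (p ^ k); have := ltn_pmod n P0; move: (n %/ _)%N (n %% _)%N => q r; nia.
Qed.

(** Each step at least doubles: C(2n+2, n+1) = 2 C(2n+1, n) >= 2 C(2n, n). *)
Lemma exp2_le_central_bin (n : nat) : (2 ^ n <= 'C(n.*2, n))%N.
Proof.
elim: n => [|n IHn]; first by rewrite bin0.
have H1 : (n.+1 * 'C(n.+1.*2, n.+1) = (n.+1.*2) * 'C(n.*2.+1, n))%N.
  by rewrite doubleS mul_bin_diag.
have H2 : ('C(n.*2, n) <= 'C(n.*2.+1, n))%N.
  by case: (n) => [|k]; rewrite ?bin0 // binS leq_addr.
rewrite expnS; nia.
Qed.

(* Every prime power in the central binomial coefficient is at most [2n]. *)
Lemma chebyshev_lower (n : nat) : (0 < n)%N ->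
  (2 ^ n <= n.*2 ^ omega n.*2`!)%N.
Proof.
move=> n0; apply: leq_trans (exp2_le_central_bin n) _.
have nn : (n <= n.*2)%N by rewrite -addnn leq_addr.
have B0 : (0 < 'C(n.*2, n))%N by rewrite bin_gt0.
rewrite (prod_prime_decomp B0) prime_decompE big_map /=.
have sub : {subset primes 'C(n.*2, n) <= primes n.*2`!}.
  move=> p; rewrite !mem_primes fact_gt0 B0 /= => /andP[-> pC] /=.
  by rewrite -(bin_fact nn) dvdn_mulr.
apply: (@leq_trans (n.*2 ^ omega 'C(n.*2, n))).
  rewrite /omega.
  have : {in primes 'C(n.*2, n), forall p, prime p}.
    by move=> p; rewrite mem_primes => /andP[].
  elim: (primes _) => [|p s IHs] ps; first by rewrite big_nil.
  rewrite big_cons expnS leq_mul ?logn_central_bin ?ps ?mem_head // IHs // => q qs.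
  by rewrite ps // in_cons qs orbT.
rewrite leq_pexp2l ?double_gt0 //.
exact: uniq_leq_size (primes_uniq _) sub.
Qed.

(** * Comparing [W] with the prime count of a single number *)

(** Two indices counted here would differ by a positive multiple of [p] smaller than [n]. *)
Lemma sum_dvd_shift_le1 (x n p : nat) : (n <= p)%N ->
  (\sum_(1 <= j < n.+1) (p %| x + j) <= 1)%N.
Proof.
move=> np.
have [/hasP[i]|/hasPn no] :=
  boolP (has (fun j => p %| x + j)%N (index_iota 1 n.+1)); last first.
  rewrite big_seq big1 // => j /no; by case: (_ %| _)%N.
rewrite mem_index_iota => ir pi.
rewrite (bigD1_seq i) ?mem_index_iota ?iota_uniq //= big_seq_cond big1 ?addn0 ?leq_b1 //.
move=> j /andP[]; rewrite mem_index_iota => jr ji.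
case: (boolP (_ %| _)%N) => // pj.
have [ij|ij] := leqP i j.
  have : (p %| (x + j) - (x + i))%N by rewrite dvdn_sub.
  by rewrite subnDl => /dvdn_leq; lia.
have : (p %| (x + i) - (x + j))%N by rewrite dvdn_sub.
by rewrite subnDl => /dvdn_leq; lia.
Qed.

Lemma omega_le_large (m0 N m : nat) : (0 < m)%N -> (0 < N)%N ->
  (forall p, prime p -> (m0 < p)%N -> (p %| m)%N -> (p %| N)%N) ->
  (omega m <= m0 + \sum_(p <- primes N) ((m0 < p) && (p %| m)))%N.
Proof.
move=> m_gt0 N_gt0 sub.
rewrite /omega -(count_predC (fun p => p <= m0)%N) leq_add //.
  rewrite -size_filter -[X in (_ <= X)%N](size_iota 1 m0); apply: uniq_leq_size.
    by rewrite filter_uniq ?primes_uniq.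
  by move=> p; rewrite mem_filter mem_primes mem_iota => /andP[pm /andP[/prime_gt0]]; lia.
have -> : (\sum_(p <- primes N) ((m0 < p) && (p %| m)) =
   size [seq p <- primes N | (m0 < p) && (p %| m)])%N.
  by rewrite -sum1_size big_filter -big_mkcond.
rewrite -size_filter; apply: uniq_leq_size; first by rewrite filter_uniq ?primes_uniq.
move=> p; rewrite !mem_filter !mem_primes /= -ltnNge => /andP[mp /and3P[pp _ pm]].
by rewrite mp pm pp N_gt0 sub.
Qed.

(** A prime above [m0] divides at most one of the [x + j], so [omega N] pays for it in full. The
    primes up to [m0] cost at most [m0] for each of the [n] indices. *)
Lemma W_le_omega (x n m0 N : nat) : (n <= m0)%N -> (0 < N)%N ->
  (forall p j, prime p -> (m0 < p)%N -> (0 < j <= n)%N -> (p %| x + j)%N ->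
     (p %| N)%N) ->
  (W x n <= omega N + n * m0)%N.
Proof.
move=> nm N0 sub; rewrite /W.
apply: (@leq_trans (\sum_(1 <= j < n.+1)
   (m0 + \sum_(p <- primes N) ((m0 < p) && (p %| x + j)))))%N.
  rewrite !big_nat; apply: leq_sum => j jn; apply: omega_le_large => //.
    by lia.
  by move=> p pp mp; apply: sub; lia.
rewrite big_split /= sum_nat_const_nat subn1 /= addnC leq_add2r exchange_big /=.
rewrite /omega -sum1_size; apply: leq_sum => p _.
case: (ltnP m0 p) => mp /=; last by rewrite big1.
by apply: sum_dvd_shift_le1; lia.
Qed.

(** * The two products: common factors and degree of the difference *)

(** Splits both products by gcd(a, bc) | gcd(a, b) gcd(a, c), one factor [M] for each pair. *)
Lemma gcdn_dvd_prod (s t : seq nat) (M : nat) :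
  {in s & t, forall a b, gcdn a b %| M}%N ->
  (gcdn (\prod_(a <- s) a) (\prod_(b <- t) b) %| M ^ (size s * size t))%N.
Proof.
have gcdM (a b c : nat) : (gcdn a (b * c) %| gcdn a b * gcdn a c)%N.
  have ga : (gcdn a (b * c) %| a)%N by exact: dvdn_gcdl.
  by rewrite muln_gcdr !muln_gcdl !dvdn_gcd !(dvdn_mulr _ ga) !(dvdn_mull _ ga) dvdn_gcdr.
move=> hM; have one a : a \in s -> (gcdn a (\prod_(b <- t) b) %| M ^ size t)%N.
  move=> as_; have {hM} : {in t, forall b, gcdn a b %| M}%N.
    by move=> b bt; apply: hM.
  elim: t => [|b t IHt] hM /=; first by rewrite big_nil gcdn1.
  rewrite big_cons expnS; apply: dvdn_trans (gcdM _ _ _) _.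
  rewrite dvdn_mul ?hM ?mem_head // IHt // => c ct.
  by rewrite hM // in_cons ct orbT.
rewrite mulnC expnM; elim: s one {hM} => [|a s IHs] one /=.
  by rewrite big_nil gcd1n.
rewrite big_cons expnS gcdnC; apply: dvdn_trans (gcdM _ _ _) _.
rewrite ![gcdn (\prod_(b <- t) b) _]gcdnC dvdn_mul ?one ?mem_head // IHs // => c cs.
by rewrite one // in_cons cs orbT.
Qed.

(* The factors of [A] and of [B], with multiplicity: [i + 1] occurs [C(n + 1, i)]
   times, in the first list for even [i] and in the second one for odd [i];
   the recursion is Pascal's rule. *)
Fixpoint shifts (n : nat) : seq nat * seq nat :=
  if n is n'.+1 then
    let: (s, t) := shifts n' in (s ++ map S t, t ++ map S s)
  else ([:: 1%N], [:: 2%N]).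

Lemma size_shifts n : size (shifts n).1 = (2 ^ n)%N /\ size (shifts n).2 = (2 ^ n)%N.
Proof.
elim: n => [|n] //=; case: (shifts n) => s t /= [hs ht].
by rewrite !size_cat !size_map hs ht expnS mul2n addnn.
Qed.

(** The parity split keeps the two lists disjoint, which bounds the gcd of the products; together
    they cover all shifts from 1 to [n + 2]. *)
Lemma mem_shifts n i :
  ((i \in (shifts n).1) = [&& 0 < i, i <= n.+2 & odd i])%N /\
  ((i \in (shifts n).2) = [&& 0 < i, i <= n.+2 & ~~ odd i])%N.
Proof.
elim: n i => [|n IHn] i.
  by rewrite /= !inE; case: i => [|[|[|i]]].
move: IHn => /=; case: (shifts n) => s t /= IHn.
have E u : (i \in map S u) = (0 < i)%N && (i.-1 \in u).
  case: i => [|i] /=; first by apply/mapP => -[].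
  by rewrite mem_map //; apply: succn_inj.
rewrite !mem_cat !E; have [-> ->] := IHn i; have [-> ->] := IHn i.-1.
clear E; case: i => [|i] //=; split; apply/idP/idP; case: (odd i);
  rewrite /= ?andbT ?andbF ?orbF; lia.
Qed.

(** Polynomials are used because the cancellation in A - B is a statement about degrees. *)
Definition shiftP (s : seq nat) : {poly int} := \prod_(i <- s) ('X + (i%:R)%:P).

Lemma shiftP_horner s (x : nat) :
  (shiftP s).[x%:R] = (\prod_(i <- s) (x + i))%N%:R.
Proof.
rewrite /shiftP horner_prod natr_prod; apply: eq_bigr => i _.
by rewrite hornerD hornerX hornerC natrD.
Qed.

Lemma size_shiftP s : size (shiftP s) = (size s).+1.
Proof.
rewrite /shiftP (eq_bigr (fun i => 'X - (- i%:R)%:P)) ?size_prod_XsubC //.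
by move=> i _; rewrite polyCN opprK.
Qed.

Lemma shiftP_cat s t : shiftP (s ++ t) = shiftP s * shiftP t.
Proof. by rewrite /shiftP big_cat. Qed.

Lemma shiftP_map s : shiftP (map S s) = shiftP s \Po ('X + 1).
Proof.
rewrite /shiftP big_map rmorph_prod; apply: eq_bigr => i _ /=.
by rewrite comp_polyD comp_polyX comp_polyC -natr1 polyCD polyC1; ring.
Qed.

(** The shift preserves degree and leading coefficient, so the top terms cancel. *)
Lemma size_comp_XD1_sub (p : {poly int}) : (size (p \Po ('X + 1) - p)%R <= (size p).-1)%N.
Proof.
have [->|p0] := eqVneq p 0; first by rewrite comp_poly0 subr0 size_poly0.
have X1 : ('X + 1 : {poly int}) = 'X - (-1)%:P by rewrite polyCN opprK.
have sX : size ('X + 1 : {poly int}) = 2%N by rewrite X1 size_XsubC.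
have sc : size (p \Po ('X + 1)) = size p by rewrite size_comp_poly2.
have lc : lead_coef (p \Po ('X + 1)) = lead_coef p.
  by rewrite lead_coef_comp ?sX // X1 lead_coefXsubC expr1n mulr1.
apply/leq_sizeP => j; rewrite leq_eqVlt => /predU1P[<-|pj].
  by rewrite coefB -{1}sc -!lead_coefE lc subrr.
rewrite coefB !nth_default ?subrr // ?sc; move: pj; case: (size p) => //.
Qed.

Definition shiftD (n : nat) : {poly int} :=
  shiftP (shifts n).1 - shiftP (shifts n).2.

(** As size is degree plus one, this means degree at most 2^n - n - 1. In the induction A and B
    become A E(B) and B E(A), with E the shift of X by 1; the new difference is a sum of two
    products, each containing a difference E(p) - p of lower degree. *)
Lemma size_shiftD n : (size (shiftD n) + n <= 2 ^ n)%N.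
Proof.
elim: n => [|n].
  rewrite /shiftD /shiftP /= !big_seq1 opprD addrACA subrr add0r -polyCN -polyCD.
  by rewrite size_polyC.
rewrite /shiftD /=; have := size_shifts n; case: (shifts n) => s t /= [hs ht].
set A := shiftP s; set B := shiftP t => IHn.
rewrite !shiftP_cat !shiftP_map -/A -/B.
have -> : A * (B \Po ('X + 1)) - B * (A \Po ('X + 1)) =
    (A - B) * (B \Po ('X + 1) - B) - B * ((A - B) \Po ('X + 1) - (A - B)).
  by rewrite comp_polyB; ring.
have := size_comp_XD1_sub (A - B); have := size_comp_XD1_sub B.
move: (B \Po _ - B) ((A - B) \Po _ - (A - B)) => U V hU hV.
have sB : size B = (2 ^ n).+1 by rewrite size_shiftP ht.
have [D0|D0] := eqVneq (A - B) 0.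
  have -> : V = 0 by apply/eqP; rewrite -size_poly_leq0; move: hV; rewrite D0 size_poly0.
  by rewrite D0 mul0r mulr0 subr0 size_poly0 ltnW // ltn_expl.
move: D0; rewrite -size_poly_gt0 => D0.
apply: (@leq_trans ((2 ^ n + (size (A - B)%R).-1) + n.+1)); last first.
  by rewrite expnS; move: D0 IHn; case: (size _) => // k; lia.
rewrite leq_add2r; apply: leq_trans (size_polyD _ _) _.
rewrite size_polyN geq_max; apply/andP; split.
  apply: leq_trans (size_polyMleq _ _) _; move: D0 hU; rewrite sB /=.
  by case: (size (A - B)) => // k _; rewrite addSn /= addnC leq_add2r.
apply: leq_trans (size_polyMleq _ _) _; rewrite sB addSn /=.
by rewrite leq_add2l.
Qed.

(** [K] is the sum of the absolute values of the coefficients. *)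
Lemma horner_bound (p : {poly int}) (e : nat) : (size p <= e.+1)%N ->
  exists K : nat, forall x : nat, (0 < x)%N -> (`|p.[x%:R]|%N <= K * x ^ e)%N.
Proof.
move=> pe; exists (\sum_(i < size p) absz (p`_i)%R)%N => x x0.
rewrite -lez_nat abszE horner_coef; apply: le_trans (ler_norm_sum _ _ _) _.
rewrite PoszM (big_morph Posz PoszD (erefl _)) mulr_suml; apply: ler_sum => i _.
rewrite normrM abszE ler_wpM2l // normrX ger0_norm ?ler0n // -natrX natz lez_nat.
rewrite leq_pexp2l //; have := ltn_ord i; lia.
Qed.

Lemma gcdn_le_sub (a b x M : nat) : a != b -> (a <= M)%N -> (b <= M)%N ->
  (gcdn (x + a) (x + b) %| M`!)%N.
Proof.
wlog ab : a b / (a <= b)%N => [H|] nab aM bM.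
  have [|/ltnW] := leqP a b; first by move/H; apply.
  by rewrite gcdnC => /H; apply; rewrite // eq_sym.
have g : (gcdn (x + a) (x + b) %| b - a)%N.
  by rewrite -(subnDl x) dvdn_sub // ?dvdn_gcdl ?dvdn_gcdr.
have ba : (0 < b - a)%N by move/eqP: nab; lia.
apply: dvdn_trans g _; apply: dvdn_fact; lia.
Qed.

(** * Construction of the abc triples *)

(** The triple consists of |A - B|, the smaller and the larger of [A] and [B], all divided by gcd(A,
    B). A prime above [G] cannot divide that gcd, so it survives the division. *)
Lemma coprime_triple (A B G : nat) : (0 < A)%N -> (0 < B)%N -> A != B ->
  (gcdn A B <= G)%N ->
  exists a b c : nat, [/\ (0 < a)%N, (0 < b)%N & (0 < c)%N] /\
    [/\ gcdn a (gcdn b c) = 1%N, (a + b = c)%N, (A <= G * c)%N,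
     (forall p, prime p -> p %| a * b * c -> p %| A * B * `|A%:Z - B%:Z|)%N &
     (forall p, prime p -> G < p -> p %| A * B -> p %| a * b * c)%N].
Proof.
wlog AB : A B / (B < A)%N => [H|] A0 B0 nAB gG.
  have [AB|AB] := ltnP B A; first exact: H.
  have AB' : (A < B)%N by rewrite ltn_neqAle nAB.
  have [||a [b [c [p0 [h1 h2 h3 h4 h5]]]]] := H B A AB' B0 A0; rewrite 1?eq_sym 1?gcdnC //.
  exists a, b, c; split=> //; split=> //.
  - by apply: leq_trans AB h3.
  - by move=> p pp /h4-/(_ pp); rewrite [(B * A)%N]mulnC distnC.
  - by move=> p pp pG; rewrite mulnC; apply: h5.
move=> {nAB}; set g := gcdn A B in gG.
have g0 : (0 < g)%N by rewrite gcdn_gt0 A0.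
have /dvdnP[c Ac] : (g %| A)%N := dvdn_gcdl _ _.
have /dvdnP[b Bb] : (g %| B)%N := dvdn_gcdr _ _.
have cb : gcdn b c = 1%N.
  apply/eqP; rewrite -(eqn_pmul2r g0) mul1n muln_gcdl -Ac -Bb gcdnC.
  by rewrite -/g.
have bc : (b < c)%N by rewrite -(ltn_pmul2r g0) -Ac -Bb.
have dAB : `|A%:Z - B%:Z|%N = ((c - b) * g)%N.
  by rewrite mulnBl -Ac -Bb distnEl // ltnW.
exists (c - b)%N, b, c; split.
  by split; [rewrite subn_gt0|case: (b) Bb B0 => // ->|exact: leq_ltn_trans bc].
split.
- by rewrite cb gcdn1.
- by rewrite subnK // ltnW.
- by rewrite Ac mulnC leq_mul2r gG orbT.
- move=> p pp; rewrite !Euclid_dvdM // dAB {1}Ac {1}Bb !Euclid_dvdM //.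
  by case/orP=> [/orP[]|] ->; rewrite ?orbT.
- move=> p pp pG; rewrite !Euclid_dvdM // {1}Ac {1}Bb !Euclid_dvdM //.
  have -> : (p %| g)%N = false.
    by apply/negP => /dvdn_leq-/(_ g0); rewrite leqNgt (leq_ltn_trans gG).
  by rewrite !orbF => /orP[]->; rewrite ?orbT.
Qed.

Lemma expn_le_prod_shift (s : seq nat) (x : nat) :
  (x ^ size s <= \prod_(i <- s) (x + i))%N.
Proof.
elim: s => [|i s IHs]; first by rewrite big_nil.
by rewrite big_cons expnS leq_mul // leq_addr.
Qed.

Lemma prime_dvd_prod_shift (s : seq nat) (x p : nat) : prime p ->
  (p %| \prod_(i <- s) (x + i))%N = has (fun i => p %| x + i)%N s.
Proof. by move=> pp; rewrite Euclid_dvd_prod // big_has. Qed.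

Lemma prod_shift_le (s : seq nat) (x m : nat) : {in s, forall i, x + i <= m}%N ->
  (\prod_(i <- s) (x + i) <= m ^ size s)%N.
Proof.
elim: s => [|i s IHs] sm; first by rewrite big_nil.
rewrite big_cons expnS leq_mul ?sm ?mem_head // IHs // => j js.
by rewrite sm // in_cons js orbT.
Qed.

(** The radical sees each [x + j] only once, whatever its multiplicity in the products; with |A - B|
    this gives the order x^(n+2) x^(2^n-n-1). *)
Lemma abc_family (n : nat) : exists K : nat, (0 < K)%N /\
  forall x : nat, (K <= x)%N -> exists a b c : nat,
    [/\ (0 < a)%N, (0 < b)%N & (0 < c)%N] /\
    [/\ gcdn a (gcdn b c) = 1%N, (a + b = c)%N, (x ^ (2 ^ n) <= K * c)%N,
     (gamma (a * b * c) <= K * x ^ (2 ^ n).+1)%N &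
     (W x n.+2 <= omega (a * b * c) + K)%N].
Proof.
have n2n : (n < 2 ^ n)%N by exact: ltn_expl.
have [K1 hK1] : exists K : nat, forall x : nat, (0 < x)%N ->
    (`|(shiftD n).[x%:R]|%N <= K * x ^ (2 ^ n - n.+1))%N.
  by apply: horner_bound; have := size_shiftD n; lia.
have [hs ht] := size_shifts n; have mem := mem_shifts n.
move: hK1; rewrite /shiftD; case: (shifts n) hs ht mem => s t /= hs ht mem hK1.
pose G := (n.+2`! ^ (2 ^ n * 2 ^ n))%N.
have G0 : (0 < G)%N by rewrite expn_gt0 fact_gt0.
(* The summands serve, in order, the bound on [c], the radical, and the small primes lost in [W]. *)
exists (G + n.+3 ^ n.+2 * K1 + n.+2 * (G + n.+2))%N; split; first by lia.
set K := (G + _ + _)%N => x Kx.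
pose A := (\prod_(i <- s) (x + i))%N; pose B := (\prod_(i <- t) (x + i))%N.
have x0 : (0 < x)%N by rewrite /K in Kx; lia.
have A0 : (x ^ (2 ^ n) <= A)%N by rewrite -hs expn_le_prod_shift.
have B0 : (x ^ (2 ^ n) <= B)%N by rewrite -ht expn_le_prod_shift.
have xd0 : (0 < x ^ (2 ^ n))%N by rewrite expn_gt0 x0.
have gG : (gcdn A B <= G)%N.
  apply: dvdn_leq => //; rewrite /A /B /G -{1}hs -ht.
  rewrite -(size_map (addn x) s) -(size_map (addn x) t).
  rewrite -(big_map (addn x) predT id) -(big_map (addn x) predT id).
  apply: gcdn_dvd_prod => _ _ /mapP[i si ->] /mapP[j tj ->].
  move: si tj; rewrite (mem i).1 (mem j).2 => /and3P[i0 iN io] /and3P[j0 jN jo].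
  by apply: gcdn_le_sub => //; apply: contraTneq io => ->.
(* Equality would make the gcd equal to [A], which is at least [x] and hence exceeds [G]. *)
have nAB : A != B.
  apply/eqP => AB; move: gG; rewrite -AB gcdnn => /(leq_trans A0).
  have : (x ^ 1 <= x ^ 2 ^ n)%N by rewrite leq_pexp2l // expn_gt0.
  by move: Kx; rewrite /K expn1; lia.
have [a [b [c [[a0 b0 c0] [gabc abc cA rad om]]]]] :=
  coprime_triple (leq_trans xd0 A0) (leq_trans xd0 B0) nAB gG.
have dvdAB (p : nat) : prime p ->
    (p %| A * B)%N = has (fun i => p %| x + i)%N (iota 1 n.+2).
  move=> pp; rewrite Euclid_dvdM // !prime_dvd_prod_shift //.
  apply/idP/hasP => [/orP[]/hasP[i]|[i]].
  - by rewrite (mem i).1 => /and3P[i0 iN _] pi; exists i; rewrite // mem_iota; lia.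
  - by rewrite (mem i).2 => /and3P[i0 iN _] pi; exists i; rewrite // mem_iota; lia.
  - rewrite mem_iota => ir pi; apply/orP; case oi: (odd i); [left|right];
      apply/hasP; exists i; rewrite // ?(mem i).1 ?(mem i).2 oi; lia.
have N0 : (0 < a * b * c)%N by rewrite !muln_gt0 a0 b0 c0.
exists a, b, c; split; split=> //.
- by apply: leq_trans A0 (leq_trans cA _); rewrite leq_mul2r /K -!addnA leq_addr orbT.
- have D0 : (0 < `|A%:Z - B%:Z|)%N.
    by rewrite absz_gt0 subr_eq0; apply: contraNneq nAB => -[->].
  have DE : A%:Z - B%:Z = (shiftP s - shiftP t).[x%:R].
    by rewrite hornerD hornerN !shiftP_horner !natz.
  have P0 : (0 < \prod_(i <- iota 1 n.+2) (x + i))%N.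
    by apply: leq_trans (expn_le_prod_shift _ _); rewrite expn_gt0 x0.
  have : (gamma (a * b * c) %| \prod_(i <- iota 1 n.+2) (x + i) * `|A%:Z - B%:Z|)%N.
    apply: gamma_dvd => p; rewrite mem_primes => /and3P[pp _ /(rad _ pp)].
    by rewrite Euclid_dvdM // dvdAB // -prime_dvd_prod_shift // -Euclid_dvdM.
  move/dvdn_leq => /(_ _)/leq_trans; apply; first by rewrite muln_gt0 P0.
  have e : (2 ^ n).+1 = (n.+2 + (2 ^ n - n.+1))%N by lia.
  apply: (@leq_trans (((n.+3 * x) ^ n.+2) * (K1 * x ^ (2 ^ n - n.+1)))).
    rewrite leq_mul // ?DE ?hK1 // -[X in (_ <= _ ^ X)%N](size_iota 1 n.+2).
    by apply: prod_shift_le => i; rewrite mem_iota; nia.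
  rewrite {1}e expnMn expnD mulnACA leq_mul2r; apply/orP; right.
  by rewrite /K; lia.
(* Primes above this threshold survive division by the gcd and divide at most one [x + j]. *)
- apply: leq_trans (W_le_omega (m0 := G + n.+2) _ N0 _) _; first by rewrite leq_addl.
    move=> p j pp pm jn pj; apply: om => //.
      by apply: leq_ltn_trans pm; rewrite leq_addr.
    by rewrite dvdAB //; apply/hasP; exists j; rewrite // mem_iota; lia.
  by rewrite leq_add2l /K leq_addl.
Qed.

(** * Estimates for logarithms *)

(** With s the square root of t, ln t = 2 ln s <= 2s, so the left side is at most 3Ms, and 3M <= es
    beyond the chosen [T]. *)
Lemma ln_affine_small (R : realType) (M e : R) : 0 <= M -> 0 < e ->
  exists T : R, 1 <= T /\ forall t : R, T <= t -> M * ln t + M <= e * t.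
Proof.
move=> M0 e0; exists (Num.max 1 ((3 * M / e) ^+ 2)); split.
  by rewrite le_max lexx.
move=> t; rewrite ge_max => /andP[t1 tM].
have t0 : 0 < t by rewrite (lt_le_trans ltr01).
set s := Num.sqrt t.
have s0 : 0 < s by rewrite sqrtr_gt0.
have st : t = s ^+ 2 by rewrite sqr_sqrtr // ltW.
have s1 : 1 <= s by rewrite -sqrtr1 ler_wsqrtr.
have sM : 3 * M / e <= s.
  rewrite -(@ler_pXn2r _ 2) ?nnegrE ?(ltW s0) -?st //.
  by rewrite divr_ge0 ?(ltW e0) ?mulr_ge0.
have lnt : ln t <= 2 * s.
  rewrite st lnXn // -[ln s *+ 2]mulr_natl ler_pM2l ?ltr0n //.
  exact: ltW (ln_sublinear s0).
move: sM; rewrite ler_pdivrMr // st => sM.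
have : M * ln t <= M * (2 * s) by rewrite ler_wpM2l.
rewrite st; nra.
Qed.

Lemma ln_nat_large (R : realType) (T : R) :
  exists N : nat, forall x : nat, (N <= x)%N -> T <= ln (x%:R : R).
Proof.
exists (Num.bound (expR T)) => x Nx.
have lex : expR T <= x%:R.
  apply: ltW; apply: (@lt_le_trans _ _ (Num.bound (expR T))%:R); last by rewrite ler_nat.
  by apply: le_lt_trans (archi_boundP _); rewrite ?ler_norm ?expR_ge0 ?lexx.
by rewrite -[T]expRK ler_ln ?posrE ?expR_gt0 // (lt_le_trans (expR_gt0 _) lex).
Qed.

Lemma ln2_ge_half (R : realType) : 2^-1 <= ln (2 : R).
Proof.
have h : ln (1 + (- 2^-1)) <= - 2^-1 :> R by apply: le_ln1Dx; lra.
have e : (1 + - 2^-1 : R) = 2^-1 by lra.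
by move: h; rewrite e lnV ?posrE // lerN2.
Qed.

Lemma ln2_le1 (R : realType) : ln (2 : R) <= 1.
Proof. by have := @le_ln1Dx R 1; rewrite -[1 + 1]/(2%:R); apply; lra. Qed.

Lemma omega_ln2_le (R : realType) (N : nat) :
  (omega N)%:R * ln (2 : R) <= ln (gamma N)%:R.
Proof.
rewrite mulr_natl -lnXn // ler_ln ?posrE ?exprn_gt0 // ?ltr0n ?gamma_gt0 //.
by rewrite -natrX ler_nat exp2_omega_le_gamma.
Qed.

Lemma ln_H (R : realType) (N : nat) : 0 < ln ((gamma N)%:R : R) ->
  0 < H R N /\
  ln (H R N) = ln (gamma N)%:R - (omega N)%:R * ln (ln ((gamma N)%:R : R)).
Proof.
move=> G0; have g0 : 0 < (gamma N)%:R :> R by rewrite ltr0n gamma_gt0.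
rewrite /H; split; first by rewrite divr_gt0 // exprn_gt0.
by rewrite ln_div ?posrE ?exprn_gt0 // lnXn // mulr_natl.
Qed.

(** * Upper bound from the conjecture *)

Lemma W_upper (R : realType) (n : nat) (delta : R) : Conjecture1 R ->
  0 < delta -> delta <= 1 ->
  exists N : nat, forall x : nat, (N <= x)%N ->
    (W x n.+2)%:R * ln (ln (x%:R : R)) <= (1 + delta) * ln x%:R.
Proof.
move=> hC d0 d1.
have [K [K0 hK]] := abc_family n.
pose d : R := (2 ^ n)%:R.
have dge1 : 1 <= d by rewrite ler1n expn_gt0.
(* The main term saves delta/2 times [L]; this choice lets the exponent 1 + eps consume only half of
   it. *)
pose eps := delta / (4 * d).
have eps0 : 0 < eps by rewrite divr_gt0 // mulr_gt0 //; lra.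
have epsd : eps * d = delta / 4 by rewrite /eps; field; lra.
have eps1 : eps <= 1 by nra.
have [C hCe] := hC eps eps0.
pose k : R := K%:R; pose lK := ln k.
have k1 : 1 <= k by rewrite ler1n.
have lK0 : 0 <= lK by rewrite ln_ge0.
have [T1 [T1ge1 hT1]] : exists T : R, 1 <= T /\
    forall t : R, T <= t -> 1 * ln t + 1 <= (delta / 4) * t.
  by apply: ln_affine_small; lra.
(* Collects the coefficients of all lower-order terms of the final inequality. *)
pose M := 3 * lK + `|ln C| + 2 * k.
have M0 : 0 <= M by rewrite /M !addr_ge0 ?mulr_ge0 //; lra.
have [T2 [T2ge1 hT2]] := @ln_affine_small R M (delta / 4) M0 ltac:(lra).
(* [hT2] is applied to ln x and [hT1] to ln ln x, hence the exponential of [T1]. *)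
have [N hN] := @ln_nat_large R (Num.max T2 (expR T1)).
exists (maxn N K) => x; rewrite geq_max => /andP[/hN]; rewrite ge_max => /andP[xT2 xT1] Kx.
set L := ln x%:R in xT2 xT1 *; set LL := ln L.
have L1 : 1 <= L by lra.
have L0 : 0 < L by lra.
have LLT1 : T1 <= LL by rewrite -[T1]expRK ler_ln ?posrE ?expR_gt0.
have LL0 : 0 < LL by lra.
have {}hT1 := hT1 _ LLT1; have {}hT2 := hT2 _ xT2; rewrite -/LL in hT2.
rewrite leNgt; apply/negP => Wbig.
have [a [b [c [[a0 b0 c0] [gabc abc cx rad Wom]]]]] := hK x Kx.
have := hCe a b c a0 b0 c0 gabc abc.
set m := (a * b * c)%N in rad Wom *; pose om : R := (omega m)%:R.
pose G : R := ln (gamma m)%:R.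
have x0 : (0 < x)%N by apply: leq_trans K0 Kx.
have x0R : 0 < (x%:R : R) by rewrite ltr0n.
have omW : (W x n.+2)%:R <= om + k by rewrite /om /k -natrD ler_nat.
have omLL : (1 + delta) * L - k * LL <= om * LL.
  have := ler_wpM2r (ltW LL0) omW; lra.
have kLL : k * LL <= delta * L.
  have ? : 0 <= M * LL by rewrite mulr_ge0 // ltW.
  have : 2 * k * LL <= M * LL.
    rewrite ler_wpM2r ?(ltW LL0) // /M.
    by have := normr_ge0 (ln C); lra.
  have ? : 0 < delta * L by rewrite mulr_gt0.
  lra.
have omL : L <= om * LL by lra.
have om0 : 0 < om by rewrite -(pmulr_lgt0 _ LL0); lra.
have Gom : om * 2^-1 <= G.
  apply: le_trans (omega_ln2_le R m).
  by rewrite ler_pM2l // ln2_ge_half.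
have G0 : 0 < G by lra.
(* Since G >= om/2 >= L/(2 LL), ln G is at least LL - ln 2 - ln LL. *)
have lnG : (1 - delta / 4) * LL <= ln G.
  have : ln (L / (2 * LL)) <= ln G.
    rewrite ler_ln ?posrE ?divr_gt0 ?mulr_gt0 //; apply: le_trans Gom.
    by rewrite ler_pdivrMr ?mulr_gt0 //; lra.
  rewrite ln_div ?posrE ?mulr_gt0 // lnM ?posrE // -/LL.
  by have := ln2_le1 R; lra.
have GL : G <= lK + (d + 1) * L.
  have : G <= ln ((K * x ^ (2 ^ n).+1)%N%:R).
    by rewrite ler_ln ?posrE ?ltr0n ?muln_gt0 ?expn_gt0 ?x0 ?K0 ?gamma_gt0 ?ler_nat.
  rewrite natrM natrX lnM ?posrE ?exprn_gt0 ?ltr0n // lnXn // -/lK -/L.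
  by rewrite -[L *+ _]mulr_natl -natr1 -/d.
have cL : d * L <= lK + ln c%:R.
  have : ln ((x ^ (2 ^ n))%N%:R) <= ln ((K * c)%N%:R : R).
    by rewrite ler_ln ?posrE ?ltr0n ?muln_gt0 ?expn_gt0 ?x0 ?K0 ?c0 ?ler_nat.
  rewrite natrX natrM lnM ?posrE ?ltr0n // lnXn // -/lK -/L.
  by rewrite -[L *+ _]mulr_natl -/d.
have [H0 lnH] := ln_H G0.
move=> cC.
have P0 : 0 < H R m `^ (1 + eps) by rewrite powR_gt0.
have c0R : 0 < (c%:R : R) by rewrite ltr0n.
(* The conjecture does not give the sign of [C]; it follows from c > 0 and allows taking
   logarithms. *)
have C0 : 0 < C by rewrite -(pmulr_lgt0 _ P0); exact: lt_trans cC.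
have : ln c%:R <= ln C + (1 + eps) * (G - om * ln G).
  rewrite -/G -/om in lnH; rewrite -lnH -ln_powR -lnM ?posrE //.
  by rewrite ler_ln ?posrE ?mulr_gt0 // ltW.
have omG : (1 - delta / 4) * ((1 + delta) * L - k * LL) <= om * ln G.
  apply: (@le_trans _ _ (om * ((1 - delta / 4) * LL))); last by rewrite ler_wpM2l // ltW.
  by rewrite mulrCA ler_wpM2l //; lra.
have dd : 1 + delta / 2 <= (1 - delta / 4) * (1 + delta) by nra.
have kLL0 : 0 <= k * LL by rewrite mulr_ge0 //; lra.
(* The many prime factors outweigh the extra [L] in the bound (d + 1) L for [G]. *)
have X1 : G - om * ln G <= lK + (d - delta / 2) * L + k * LL.
  have := ler_wpM2r (ltW L0) dd; have : 0 <= delta * (k * LL) by rewrite mulr_ge0 //; lra.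
  nra.
move=> Hc.
have X2 : (1 + eps) * (G - om * ln G) <=
    2 * lK + (d - delta / 4) * L + 2 * (k * LL).
  apply: le_trans (ler_wpM2l _ X1) _; first lra.
  have ? : eps * lK <= 1 * lK by rewrite ler_wpM2r.
  have ? : eps * (k * LL) <= 1 * (k * LL) by rewrite ler_wpM2r.
  have E : eps * ((d - delta / 2) * L) = (delta / 4) * L - eps * (delta / 2 * L).
    by rewrite mulrA mulrBr epsd; ring.
  have ? : 0 <= eps * (delta / 2 * L) by rewrite mulr_ge0 ?(ltW eps0) // mulr_ge0 //; lra.
  lra.
have nC := ler_norm (ln C).
have ? : 0 <= lK * LL by rewrite mulr_ge0 // ltW.
have ? : 0 <= `|ln C| * LL by rewrite mulr_ge0 // ltW.
(* The spare positive term 2k makes the closing contradiction strict. *)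
have XM : 3 * lK + `|ln C| + 2 * (k * LL) + 2 * k <= M * LL + M by rewrite /M; lra.
lra.
Qed.

(** * Lower bound along primorials *)

Lemma W_lower (R : realType) (y : nat) (delta : R) (N : nat) : (0 < y)%N ->
  0 < delta -> delta <= 1 ->
  exists x : nat, (N <= x)%N /\
    (1 - delta) * ln (x%:R : R) <= (W x y)%:R * ln (ln (x%:R : R)).
Proof.
move=> y0 d0 d1.
have [T1 [T1ge1 hT1]] : exists T : R, 1 <= T /\
    forall t : R, T <= t -> 4 * ln t + 4 <= delta * t.
  by apply: ln_affine_small; lra.
(* Applied to t = m, this forces at least N + 4 primes up to [m], and so x > N. *)
have [T2 [T2ge1 hT2]] : exists T : R, 1 <= T /\
    forall t : R, T <= t -> N.+4%:R * ln t + N.+4%:R <= 4^-1 * t.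
  by apply: ln_affine_small; rewrite ?ler0n //; lra.
have [k0 hk0] := @ln_nat_large R (Num.max T2 T1).
pose k := k0.+1; pose m := k.*2.
have km : (k0 <= m)%N by rewrite /m /k; lia.
have := hk0 m km; rewrite ge_max => /andP[mT2 mT1].
have m0 : (0 < m)%N by rewrite /m /k; lia.
have m0R : 0 < (m%:R : R) by rewrite ltr0n.
set l := ln (m%:R : R) in mT1 mT2.
have l0 : 0 < l by lra.
have lm : l <= m%:R by rewrite ltW // ln_sublinear.
have {}hT1 := hT1 _ mT1; have {}hT2 := hT2 m%:R ltac:(lra).
rewrite -/l in hT2.
pose p : R := (omega m`!)%:R.
(* Chebyshev's bound with k = m/2 and ln 2 >= 1/2. *)
have pm : 4^-1 * m%:R <= p * l.
  have kp : (k%:R : R) * ln 2 <= p * l.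
    rewrite !mulr_natl -!lnXn // ler_ln ?posrE ?exprn_gt0 // -!natrX ler_nat.
    exact: chebyshev_lower.
  have mk : (m%:R : R) = 2 * k%:R by rewrite /m -mul2n natrM.
  have := @ln2_ge_half R; have : 0 <= (k%:R : R) by [].
  rewrite mk; nra.
have pN : N.+4%:R <= p.
  rewrite -(ler_pM2r l0); apply: le_trans pm; apply: le_trans hT2.
  by rewrite lerDl.
have N0 : 0 <= (N%:R : R) by [].
have p4 : 4 <= p by apply: le_trans pN; rewrite ler_nat.
have px := exp2_omega_le_gamma m`!.
have oN : (N.+4 <= omega m`!)%N by rewrite -(ler_nat R).
have om0 : (0 < omega m`!)%N by apply: leq_trans oN.
have [x x1] : exists x, x.+1 = gamma m`!.
  by exists (gamma m`!).-1; rewrite prednK // gamma_gt0.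
have xN : (N.+4 < x.+1)%N.
  by rewrite x1; apply: leq_trans px; apply: leq_ltn_trans oN (ltn_expl _ _).
have Nx : (N < x)%N.
  by clear -xN; lia.
have x0 : (0 < x)%N by apply: leq_ltn_trans Nx.
exists x; split; first exact: ltnW.
have Wp : p <= (W x y)%:R.
  by rewrite ler_nat /W big_ltn // addn1 x1 omega_gamma leq_addr.
have Lx : ln x%:R <= p * l.
  rewrite /p mulr_natl -lnXn // ler_ln ?posrE ?ltr0n ?exprn_gt0 // -natrX ler_nat.
  apply: leq_trans (leqnSn _) _; rewrite x1; apply: (gamma_le_exp_omega _) => q.
  by rewrite primes_fact => /andP[].
(* As x is one less than the primorial, one factor 2 is given up; p >= 4 absorbs it. *)
have xL : p / 4 <= ln x%:R.
  have : ln (2 ^ (omega m`!).-1)%N%:R <= ln (x%:R : R).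
    rewrite ler_ln ?posrE ?ltr0n ?expn_gt0 // ler_nat -ltnS x1.
    apply: leq_trans px; rewrite -[in X in (_ < X)%N](prednK om0).
    by rewrite ltn_exp2l.
  rewrite natrX lnXn // -[ln 2 *+ _]mulr_natl.
  have -> : (omega m`!).-1%:R = p - 1 :> R by rewrite -subn1 natrB.
  by have := @ln2_ge_half R; nra.
have LLl : (1 - delta) * l <= ln (ln x%:R).
  (* The 16 is the product of the 4 in [pm] and the 4 in [xL]. *)
  have : ln (m%:R / (2 ^+ 4 * l)) <= ln (ln x%:R).
    rewrite ler_ln ?posrE ?divr_gt0 ?mulr_gt0 ?exprn_gt0 //; last lra.
    apply: le_trans xL; rewrite ler_pdivrMr ?mulr_gt0 ?exprn_gt0 //; lra.
  rewrite ln_div ?posrE ?mulr_gt0 ?exprn_gt0 // lnM ?posrE ?exprn_gt0 // lnXn //.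
  rewrite -[ln 2 *+ _]mulr_natl -/l; have := @ln2_le1 R.
  have : 0 <= ln l by rewrite ln_ge0 //; lra.
  lra.
have LL0 : 0 <= ln (ln (x%:R : R)) by apply: le_trans LLl; rewrite mulr_ge0 //; lra.
apply: le_trans (ler_wpM2r LL0 Wp).
apply: (@le_trans _ _ ((1 - delta) * (p * l))); first by rewrite ler_wpM2l //; lra.
by rewrite mulrCA ler_wpM2l //; lra.
Qed.

(** * Passage to the limit superior *)

Lemma limsup_eq1 (R : realType) (u : nat -> R) :
  (forall e : R, 0 < e -> e <= 1 -> exists N, forall x, (N <= x)%N -> u x <= 1 + e) ->
  (forall (e : R) N, 0 < e -> e <= 1 -> exists x, (N <= x)%N /\ 1 - e <= u x) ->
  limn_esup (fun x => (u x)%:E) = 1%E.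
Proof.
move=> hu hl; have mine (e : R) : 0 < e -> 0 < Num.min e 1 /\ Num.min e 1 <= 1.
  by move=> e0; rewrite lt_min e0 ltr01 ge_min lexx orbT.
apply/eqP; rewrite eq_le; apply/andP; split; apply/lee_addgt0Pr => e e0.
  have [e1 e2] := mine e e0; have [N hN] := hu _ e1 e2.
  rewrite /limn_esup limf_esupE.
  apply: (@le_trans _ _ (ereal_sup ((fun x => (u x)%:E) @` [set x | (N <= x)%N])%classic)).
    by apply: ereal_inf_lbound; exists [set x | (N <= x)%N]%classic => //; exists N.
  apply: ge_ereal_sup => _ [x /= Nx <-].
  rewrite -EFinD lee_fin; apply: le_trans (hN x Nx) _.
  by rewrite lerD2l ge_min lexx.
rewrite -leeBlDr // /limn_esup limf_esupE.
(* The limsup is an infimum over all sets containing a tail, and each such set meets a large value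
   of [u]. *)
apply: le_ereal_inf_tmp => _ [A [N _ NA] <-].
have [e1 e2] := mine e e0; have [x [Nx ux]] := hl _ N e1 e2.
apply: (@le_trans _ _ (u x)%:E); last first.
  by apply: ereal_sup_ubound; exists x => //; apply: NA.
rewrite -EFinB lee_fin; apply: le_trans ux.
by rewrite lerB // ge_min lexx.
Qed.

Lemma leq_W (x y z : nat) : (y <= z)%N -> (W x y <= W x z)%N.
Proof.
by move=> yz; rewrite /W [X in (_ <= X)%N](big_cat_nat (n := y.+1)) //= leq_addr.
Qed.

Theorem corollary1 (R : realType) (hC : Conjecture1 R) (y : nat)
    (hy : (0 < y)%N) :
  limn_esup (fun x : nat =>
    (((W x y)%:R * ln (ln (x%:R : R)) / ln (x%:R : R))%:E : \bar R)) = 1%E.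
Proof.
have [N0 hN0] := @ln_nat_large R (expR 1).
have pos x : (N0 <= x)%N -> 0 < ln (x%:R : R) /\ 0 <= ln (ln (x%:R : R)).
  move=> /hN0 xe; have x0 := lt_le_trans (expR_gt0 1) xe; split=> //.
  by rewrite ln_ge0 // (le_trans _ xe) // ltW // expR_gt1.
apply: limsup_eq1 => e.
  (* Taking n = y bounds [W x y.+2], which dominates [W x y]. *)
  move=> e0 e1; have [N hN] := W_upper y hC e0 e1.
  exists (maxn N N0) => x; rewrite geq_max => /andP[/hN Wx /pos[L0 LL0]].
  rewrite ler_pdivrMr //; apply: le_trans Wx.
  by rewrite ler_wpM2r // ler_nat leq_W // ltnW.
move=> N e0 e1; have [x [Nx Wx]] := W_lower (maxn N N0) hy e0 e1.
move: Nx; rewrite geq_max => /andP[Nx /pos[L0 _]].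
by exists x; split=> //; rewrite ler_pdivlMr.
Qed.
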